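(* The functor $\alpha^{-1} \colon \mathrm{Mod}(\mathbf{k}_{\mathbb{V}_{\mathfrak{a}}}) \to \mathrm{Mod}(\mathbf{k}_{\mathbb{V}_\gamma})$ induces an equivalence of categories between the quotient abelian category $\mathrm{Mod}(\mathbf{k}_{\mathbb{V}_{\mathfrak{a}}}) / \mathrm{Eph}(\mathbf{k}_{\mathbb{V}_{\mathfrak{a}}})$ and $\mathrm{Mod}(\mathbf{k}_{\mathbb{V}_\gamma})$.
   Context: $\mathbf{k}$ is a field and $\mathbb{V}$ is a finite dimensional real vector space. $\gamma\subset\mathbb{V}$ is a closed convex cone ($\mathbb{R}_{>0}\gamma\subset\gamma$) with non-empty interior $\mathrm{Int}(\gamma)$ (interior for the usual topology), and is proper: $\gamma\cap(-\gamma)=\{0\}$. $\mathbb{V}_\gamma$ is $\mathbb{V}$ with the $\gamma$-topology: the open sets are the subsets $U$ which are open for the usual topology and satisfy $U+\gamma=U$. $\mathbb{V}_{\mathfrak{a}}$ is $\mathbb{V}$ with the Alexandrov topology of the order $x\le_\gamma y \Leftrightarrow x+\gamma\subset y+\gamma$: the open sets are all lower sets, i.e. all subsets $U$ with $U+\gamma=U$. For a topological space $X$, $\mathrm{Mod}(\mathbf{k}_X)$ is the category of sheaves of $\mathbf{k}$-modules on $X$. $\alpha\colon \mathbb{V}_\gamma\to\mathbb{V}_{\mathfrak{a}}$ is the morphism of sites given by the functor $\alpha^t\colon \mathrm{Op}(\mathbb{V}_{\mathfrak{a}})\to\mathrm{Op}(\mathbb{V}_\gamma)$, $U\mapsto U+\mathrm{Int}(\gamma)$;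 so $(\alpha_*G)(U)=G(U+\mathrm{Int}(\gamma))$, and $\alpha^{-1}$ is the (exact) left adjoint of $\alpha_*$. $\beta\colon\mathbb{V}_{\mathfrak{a}}\to\mathbb{V}_\gamma$ is the identity map, which is continuous; so $(\beta_*F)(U)=F(U)$ for $U$ a $\gamma$-open set. A sheaf $F\in\mathrm{Mod}(\mathbf{k}_{\mathbb{V}_{\mathfrak{a}}})$ is ephemeral if $\beta_*F\simeq 0$. $\mathrm{Eph}(\mathbf{k}_{\mathbb{V}_{\mathfrak{a}}})$ is the full subcategory of ephemeral sheaves; it is a Serre subcategory, and the quotient is the quotient of an abelian category by a Serre subcategory. *)

(* Defs.v *)
From HB Require Import structures.
From mathcomp Require Import all_boot all_order all_algebra.
From mathcomp Require Import all_classical all_reals all_analysis.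

Set Implicit Arguments.
Unset Strict Implicit.
Unset Printing Implicit Defensive.

Import Order.TTheory GRing.Theory Num.Theory numFieldNormedType.Exports.
Local Open Scope classical_set_scope.
Local Open Scope ring_scope.

Record category := Category {
  ob :> Type;
  mor : ob -> ob -> Type;
  idmor : forall x, mor x x;
  mcomp : forall x y z, mor y z -> mor x y -> mor x z;
  comp1m : forall x y (f : mor x y), mcomp (idmor y) f = f;
  compm1 : forall x y (f : mor x y), mcomp f (idmor x) = f;
  compA : forall x y z w (h : mor z w) (g : mor y z) (f : mor x y),
    mcomp h (mcomp g f) = mcomp (mcomp h g) f }.

Arguments idmor {c} x.
Arguments mcomp {c x y z} g f.

Notation "g \oc f" := (mcomp g f) (at level 50, left associativity).

Record functor (C D : category) := Functor {
  fob :> C -> D;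
  fmor : forall x y, mor x y -> mor (fob x) (fob y);
  fmap1 : forall x, fmor (idmor x) = idmor (fob x);
  fmapM : forall x y z (g : mor y z) (f : mor x y),
    fmor (g \oc f) = fmor g \oc fmor f }.

Arguments fmor {C D} F {x y} f : rename.

Record nattrans (C D : category) (F G : functor C D) := Nattrans {
  nt :> forall x : C, mor (F x) (G x);
  ntP : forall (x y : C) (f : mor x y), nt y \oc fmor F f = fmor G f \oc nt x }.

Lemma nattrans_eq (C D : category) (F G : functor C D) (a b : nattrans F G) :
  (forall x, a x = b x) -> a = b.
Proof.
case: a b => [a aP] [b bP] /= ab.
have eab : a = b by apply: functional_extensionality_dep.
by case: _ / eab in bP *; congr Nattrans; exact: Prop_irrelevance.
Qed.

Definition idF (C : category) : functor C C :=
  @Functor C C id (fun _ _ f => f) (fun _ => erefl) (fun _ _ _ _ _ => erefl).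

Section CompF.
Variables (C D E : category) (G : functor D E) (F : functor C D).

Fact compF_1 (x : C) : fmor G (fmor F (idmor x)) = idmor (G (F x)).
Proof. by rewrite !fmap1. Qed.

Fact compF_M (x y z : C) (g : mor y z) (f : mor x y) :
  fmor G (fmor F (g \oc f)) = fmor G (fmor F g) \oc fmor G (fmor F f).
Proof. by rewrite !fmapM. Qed.

Definition compF : functor C E :=
  @Functor C E (fun x => G (F x)) (fun _ _ f => fmor G (fmor F f))
    compF_1 compF_M.
End CompF.

Section FunctorCategory.
Variables C D : category.

Definition nt_id (F : functor C D) : nattrans F F.
Proof.
by exists (fun x => idmor (F x)) => x y f; rewrite comp1m compm1.
Defined.

Definition nt_comp (F G H : functor C D) (b : nattrans G H) (a : nattrans F G) :
  nattrans F H.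
Proof.
exists (fun x => b x \oc a x) => x y f.
by rewrite -compA ntP !compA ntP.
Defined.

Definition functor_cat : category.
Proof.
refine (@Category (functor C D) (@nattrans C D) nt_id nt_comp _ _ _) => *;
  apply: nattrans_eq => x /=; [exact: comp1m|exact: compm1|exact: compA].
Defined.
End FunctorCategory.

Definition opcat (C : category) : category :=
  @Category C (fun x y => mor y x) (fun x => idmor x) (fun _ _ _ g f => f \oc g)
    (fun _ _ f => compm1 f) (fun _ _ f => comp1m f)
    (fun _ _ _ _ h g f => esym (compA f g h)).

Definition full_subcat (C : category) (P : C -> Prop) : category :=
  @Category {x : C | P x} (fun x y => mor (sval x) (sval y))
    (fun x => idmor (sval x)) (fun _ _ _ g f => g \oc f)
    (fun _ _ f => comp1m f) (fun _ _ f => compm1 f)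
    (fun _ _ _ _ h g f => compA h g f).

Definition is_iso (C : category) (x y : C) (f : mor x y) :=
  exists g : mor y x, g \oc f = idmor x /\ f \oc g = idmor y.

Definition isomorphic (C : category) (x y : C) :=
  exists f : mor x y, is_iso f.

Definition natiso (C D : category) (F G : functor C D) :=
  @isomorphic (functor_cat C D) F G.

Definition is_equivalence (C D : category) (F : functor C D) :=
  exists G : functor D C, natiso (compF G F) (idF C) /\ natiso (compF F G) (idF D).

Record adjunction (C D : category) (L : functor C D) (R : functor D C) :=
  Adjunction {
  adj_unit : nattrans (idF C) (compF R L);
  adj_counit : nattrans (compF L R) (idF D);
  adj_triangleL : forall x : C,
    adj_counit (L x) \oc fmor L (adj_unit x) = idmor (L x);
  adj_triangleR : forall y : D,
    fmor R (adj_counit y) \oc adj_unit (R y) = idmor (R y) }.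

Section Kernels.
Variable C : category.

Definition is_zero_ob (z : C) :=
  (forall x : C, exists f : mor x z, forall g, g = f) /\
  (forall x : C, exists f : mor z x, forall g, g = f).

(** In a category with a zero object, these are the zero morphisms. *)
Definition is_zero_hom (x y : C) (f : mor x y) :=
  exists (z : C) (h : mor z y) (g : mor x z), is_zero_ob z /\ f = h \oc g.

Definition is_kernel (k x y : C) (f : mor x y) (i : mor k x) :=
  is_zero_hom (f \oc i) /\
  forall (t : C) (g : mor t x), is_zero_hom (f \oc g) ->
    exists! h : mor t k, i \oc h = g.

Definition is_cokernel (x y c : C) (f : mor x y) (p : mor y c) :=
  is_zero_hom (p \oc f) /\
  forall (t : C) (g : mor y t), is_zero_hom (g \oc f) ->
    exists! h : mor c t, h \oc p = g.

Definition ker_coker_in (S : C -> Prop) (x y : C) (f : mor x y) : Prop :=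
  (exists (k : C) (i : mor k x), is_kernel f i /\ S k) /\
  (exists (c : C) (p : mor y c), is_cokernel f p /\ S c).
End Kernels.

(** The localization C[W^-1]: morphisms are zigzags of morphisms of C and
    formal inverses of elements of W, in diagrammatic order, modulo the
    congruence generated by functoriality and by the relations making the
    formal inverses two-sided inverses. *)
Section Localization.
Variables (C : category) (W : forall x y : C, mor x y -> Prop).

Inductive zigzag : C -> C -> Type :=
| Znil x : zigzag x x
| Zfwd x y z (f : mor x y) (p : zigzag y z) : zigzag x z
| Zbwd x y z (s : mor y x) (Ws : W s) (p : zigzag y z) : zigzag x z.

Inductive zeq : forall x y, zigzag x y -> zigzag x y -> Prop :=
| Zeq_refl x y (p : zigzag x y) : zeq p p
| Zeq_sym x y (p q : zigzag x y) : zeq p q -> zeq q p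
| Zeq_trans x y (q p r : zigzag x y) : zeq p q -> zeq q r -> zeq p r
| Zeq_fwd x y z (f : mor x y) (p q : zigzag y z) :
    zeq p q -> zeq (Zfwd f p) (Zfwd f q)
| Zeq_bwd x y z (s : mor y x) (Ws : W s) (p q : zigzag y z) :
    zeq p q -> zeq (Zbwd Ws p) (Zbwd Ws q)
| Zeq_id x y (p : zigzag x y) : zeq (Zfwd (idmor x) p) p
| Zeq_comp x y z w (f : mor x y) (g : mor y z) (p : zigzag z w) :
    zeq (Zfwd f (Zfwd g p)) (Zfwd (g \oc f) p)
| Zeq_fwdK x y z (s : mor x y) (Ws : W s) (p : zigzag x z) :
    zeq (Zfwd s (Zbwd Ws p)) p
| Zeq_bwdK x y z (s : mor y x) (Ws : W s) (p : zigzag x z) :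
    zeq (Zbwd Ws (Zfwd s p)) p.

Fixpoint zcat x y z (p : zigzag x y) : zigzag y z -> zigzag x z :=
  match p with
  | Znil _ => fun q => q
  | Zfwd _ _ _ f p' => fun q => Zfwd f (zcat p' q)
  | Zbwd _ _ _ s Ws p' => fun q => Zbwd Ws (zcat p' q)
  end.

Lemma zcatp0 x y (p : zigzag x y) : zcat p (Znil y) = p.
Proof. by elim: p => //= [? ? ? f p ->|? ? ? s Ws p ->]. Qed.

Lemma zcatA x y z w (p : zigzag x y) (q : zigzag y z) (r : zigzag z w) :
  zcat p (zcat q r) = zcat (zcat p q) r.
Proof. by elim: p q => //= [? ? ? f p IH q|? ? ? s Ws p IH q]; rewrite IH. Qed.

Lemma zeq_catl x y z (p : zigzag x y) (q q' : zigzag y z) :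
  zeq q q' -> zeq (zcat p q) (zcat p q').
Proof.
by elim: p q q' => //= [? ? ? f p IH q q' e|? ? ? s Ws p IH q q' e];
  constructor; apply: IH.
Qed.

Lemma zeq_catr x y z (p p' : zigzag x y) (q : zigzag y z) :
  zeq p p' -> zeq (zcat p q) (zcat p' q).
Proof.
move=> e; elim: e q => /=; try by move=> *; constructor; auto.
by move=> ? ? p1 ? ? _ IH1 _ IH2 q; apply: Zeq_trans (IH1 q) (IH2 q).
Qed.

Definition loc_hom (x y : C) : Type :=
  {A : zigzag x y -> Prop | exists p, A = zeq p}.

Definition loc_class x y (p : zigzag x y) : loc_hom x y :=
  exist _ (zeq p) (ex_intro _ p erefl).

Lemma loc_classP x y (p q : zigzag x y) :
  loc_class p = loc_class q <-> zeq p q.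
Proof.
split=> [/(congr1 sval) /= ->|pq]; first exact: Zeq_refl.
apply: eq_exist => /=; apply: funext => r; apply: propext.
by split; [apply: Zeq_trans; exact: Zeq_sym|exact: Zeq_trans].
Qed.

Definition loc_repr x y (f : loc_hom x y) : zigzag x y := sval (cid (svalP f)).

Lemma loc_reprK x y (f : loc_hom x y) : loc_class (loc_repr f) = f.
Proof.
by case: f => A fA; rewrite /loc_repr; case: cid => p /= e; apply/eq_exist/esym.
Qed.

Definition loc_comp x y z (g : loc_hom y z) (f : loc_hom x y) : loc_hom x z :=
  loc_class (zcat (loc_repr f) (loc_repr g)).

Lemma loc_compE x y z (q : zigzag y z) (p : zigzag x y) :
  loc_comp (loc_class q) (loc_class p) = loc_class (zcat p q).
Proof.
apply/loc_classP; apply: (Zeq_trans (q := zcat p (loc_repr (loc_class q)))).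
  by apply: zeq_catr; apply/loc_classP; exact: loc_reprK.
by apply: zeq_catl; apply/loc_classP; exact: loc_reprK.
Qed.

Definition localization : category.
Proof.
refine (@Category C loc_hom (fun x => loc_class (Znil x)) loc_comp _ _ _).
- by move=> x y f; rewrite -(loc_reprK f) loc_compE zcatp0.
- by move=> x y f; rewrite -(loc_reprK f) loc_compE.
- move=> x y z w h g f.
  by rewrite -(loc_reprK f) -(loc_reprK g) -(loc_reprK h) !loc_compE zcatA.
Defined.

Definition localization_functor : functor C localization.
Proof.
refine (@Functor C localization id
  (fun x y f => loc_class (Zfwd f (Znil y))) _ _).
- by move=> x; apply/loc_classP; exact: Zeq_id.
- move=> x y z g f /=; rewrite /= loc_compE /=.
  by apply/loc_classP/Zeq_sym; exact: Zeq_comp.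
Defined.
End Localization.

(** For C abelian and S a Serre subcategory (given by its class of objects),
    C/S is the localization of C at the morphisms whose kernel and cokernel
    belong to S. *)
Definition serre_quotient (C : category) (S : C -> Prop) : category :=
  localization (ker_coker_in S).

Definition serre_quotient_functor (C : category) (S : C -> Prop) :
  functor C (serre_quotient S) := localization_functor (ker_coker_in S).

Section ModCat.
Variable k : fieldType.

Lemma linear_eq (U V : lmodType k) (f g : {linear U -> V}) : f =1 g -> f = g.
Proof.
case: f g => [f cf] [g cg] /= /funext fg; move: cf cg; rewrite fg => cf cg.
congr GRing.Linear.Pack.
case: cf cg => [[f1] [f2]] [[g1] [g2]]; congr GRing.Linear.Class.
  by congr Algebra.isNmodMorphism.Axioms_; exact: Prop_irrelevance.
by congr GRing.isScalable.Axioms_; exact: Prop_irrelevance.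
Qed.

Definition modcat : category.
Proof.
refine (@Category (lmodType k) (fun U V => {linear U -> V})
  (fun U => idfun) (fun U V W g f => g \o f) _ _ _) => *; exact: linear_eq.
Defined.
End ModCat.

Section Opens.
Variable X : topologicalType.

Definition opens := {U : set X | open U}.

Definition opens_set (U : opens) : set X := sval U.
Coercion opens_set : opens >-> set.

Definition opensI (U W : opens) : opens :=
  exist _ (U `&` W) (openI (svalP U) (svalP W)).

Lemma opensIl (U W : opens) : opensI U W `<=` U.
Proof. exact: subIsetl. Qed.

Lemma opensIr (U W : opens) : opensI U W `<=` W.
Proof. exact: subIsetr. Qed.

Definition opens_cat : category :=
  @Category opens (fun U W : opens => U `<=` W) (fun U => @subset_refl _ U)
    (fun U V W h g => subset_trans g h)
    (fun _ _ _ => Prop_irrelevance _ _) (fun _ _ _ => Prop_irrelevance _ _)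
    (fun _ _ _ _ _ _ _ => Prop_irrelevance _ _).
End Opens.

Section Sheaves.
Variables (k : fieldType) (X : topologicalType).

Definition presheaf_cat : category :=
  functor_cat (opcat (opens_cat X)) (modcat k).

Definition sections (F : presheaf_cat) (U : opens X) : lmodType k :=
  (F : functor (opcat (opens_cat X)) (modcat k)) U.

Definition restr (F : presheaf_cat) (U W : opens X) (UW : U `<=` W) :
    {linear sections F W -> sections F U} :=
  fmor (F : functor (opcat (opens_cat X)) (modcat k))
    (UW : @mor (opcat (opens_cat X)) W U).

Definition is_sheaf (F : presheaf_cat) :=
  forall (U : opens X) (I : Type) (c : I -> opens X)
    (cU : forall i, c i `<=` U), U `<=` \bigcup_i c i ->
  forall s : forall i, sections F (c i),
    (forall i j, restr F (@opensIl _ (c i) (c j)) (s i) =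
               restr F (@opensIr _ (c i) (c j)) (s j)) ->
  exists! t : sections F U, forall i, restr F (cU i) t = s i.

Definition Mod : category := full_subcat is_sheaf.
End Sheaves.

(** Morphisms of sites X -> Y, given by functors Op(Y) -> Op(X) compatible
    with intersections and with coverings. *)
Record site_morphism (X Y : topologicalType) := SiteMorphism {
  site_map :> opens Y -> opens X;
  site_mono : forall U W : opens Y, U `<=` W -> site_map U `<=` site_map W;
  site_cap : forall U W : opens Y,
    site_map U `&` site_map W `<=` site_map (opensI U W);
  site_cover : forall (U : opens Y) (I : Type) (c : I -> opens Y),
    U `<=` \bigcup_i c i -> site_map U `<=` \bigcup_i site_map (c i) }.

Section DirectImage.
Variables (k : fieldType) (X Y : topologicalType) (f : site_morphism X Y).

Definition site_functor : functor (opcat (opens_cat Y)) (opcat (opens_cat X)) :=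
  @Functor (opcat (opens_cat Y)) (opcat (opens_cat X)) f
    (fun U W UW => site_mono UW)
    (fun U => @Prop_irrelevance (f U `<=` f U) _ _)
    (fun U V W _ _ => @Prop_irrelevance (f W `<=` f U) _ _).

Definition presheaf_direct_image (G : presheaf_cat k X) : presheaf_cat k Y :=
  compF G site_functor.

Fact restr_irr (G : presheaf_cat k X) (U W : opens X) (h h' : U `<=` W) s :
  restr G h s = restr G h' s.
Proof. by rewrite (Prop_irrelevance h h'). Qed.

Fact restr_comp (G : presheaf_cat k X) (U V W : opens X)
  (h : U `<=` V) (g : V `<=` W) (h' : U `<=` W) s :
  restr G h (restr G g s) = restr G h' s.
Proof.
rewrite (Prop_irrelevance h' (subset_trans h g)).
by have /(congr1 (fun u : {linear _ -> _} => u s)) := @fmapM _ _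
  (G : functor (opcat (opens_cat X)) (modcat k)) W V U h g.
Qed.

Fact restr_direct_image (G : presheaf_cat k X) (U W : opens Y) (h : U `<=` W)
    (s : sections G (f W)) :
  restr (presheaf_direct_image G) h s = restr G (site_mono h) s.
Proof. by []. Qed.

Fact direct_image_sheaf (G : presheaf_cat k X) :
  is_sheaf G -> is_sheaf (presheaf_direct_image G).
Proof.
move=> Gsh U I c cU Uc s ss.
apply: (Gsh (f U) I (fun i => f (c i)) (fun i => site_mono (cU i))
  (site_cover Uc) s) => i j.
have h : opensI (f (c i)) (f (c j)) `<=` f (opensI (c i) (c j)).
  exact: site_cap.
have := ss i j; rewrite !restr_direct_image => /(congr1 (restr G h)).
set hi := (X in restr G X (s i)); set hj := (X in restr G X (s j)).
rewrite (restr_comp h hi (@opensIl _ (f (c i)) (f (c j)))).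
by rewrite (restr_comp h hj (@opensIr _ (f (c i)) (f (c j)))).
Qed.

Definition presheaf_direct_image_hom (F G : presheaf_cat k X) (a : mor F G) :
  mor (presheaf_direct_image F) (presheaf_direct_image G) :=
  @Nattrans _ _ (presheaf_direct_image F) (presheaf_direct_image G)
    (fun U => (a : nattrans F G) (f U))
    (fun U W h => @ntP _ _ _ _ a (f U) (f W) (site_mono h)).

Fact presheaf_direct_image_1 (F : presheaf_cat k X) :
  presheaf_direct_image_hom (idmor F) = idmor (presheaf_direct_image F).
Proof. by apply: nattrans_eq. Qed.

Fact presheaf_direct_image_M (F G H : presheaf_cat k X)
    (b : mor G H) (a : mor F G) :
  presheaf_direct_image_hom (b \oc a) =
  presheaf_direct_image_hom b \oc presheaf_direct_image_hom a.
Proof. by apply: nattrans_eq. Qed.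

Definition direct_image : functor (Mod k X) (Mod k Y) :=
  @Functor (Mod k X) (Mod k Y)
    (fun F => exist _ (presheaf_direct_image (sval F))
                      (direct_image_sheaf (svalP F)))
    (fun F G a => presheaf_direct_image_hom a)
    (fun F => presheaf_direct_image_1 (sval F))
    (fun F G H b a => presheaf_direct_image_M b a).
End DirectImage.

Section SiteOfContinuous.
Variables (X Y : topologicalType) (f : X -> Y).

Fact site_of_cts_open (fcts : continuous f) (U : opens Y) :
  open (f @^-1` U).
Proof. by move/continuousP: fcts; apply; exact: (svalP U). Qed.

Definition site_of_cts (fcts : continuous f) : site_morphism X Y :=
  @SiteMorphism X Y (fun U => exist _ (f @^-1` U) (site_of_cts_open fcts U))
    (fun U W UW x => UW (f x)) (fun U W x UWx => UWx)
    (fun U I c Uc x Ux => Uc (f x) Ux).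
End SiteOfContinuous.

(** Finite dimensional normed spaces.  All norms on a finite dimensional real
    vector space are equivalent, so the norm only provides the usual
    topology. *)
#[short(type="normedVectType")]
HB.structure Definition NormedVector (R : numDomainType) :=
  {V of Vector R V & NormedModule R V}.

HB.instance Definition _ (R : realType) (n : nat) := NormedModule.on 'rV[R]_n.

Definition minkowski_sum (V : zmodType) (A B : set V) : set V :=
  [set a + b | a in A & b in B].

Record proper_cone (R : realType) (V : normedVectType R) := ProperCone {
  cone_set :> set V;
  cone_closed : closed cone_set;
  cone_convex : convex_set (cone_set : set (convex_lmodType V));
  cone_scale : forall (t : R) (x : V), 0 < t -> cone_set x -> cone_set (t *: x);
  cone_int : cone_set° !=set0;
  cone_pointed : cone_set `&` [set - x | x in cone_set] = [set 0] }.

(** The carriers of the two topologies; the argument g only serves to select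
    the topological structure. *)
Definition Vgamma (R : realType) (V : normedVectType R) (g : proper_cone V) :
  Type := V.
Definition Valex (R : realType) (V : normedVectType R) (g : proper_cone V) :
  Type := V.

Section ConeTopologies.
Variables (R : realType) (V : normedVectType R) (g : proper_cone V).
Implicit Types (U W : set V) (x y : V).

Local Notation "A \+m B" := (minkowski_sum A B) (at level 50).
Local Notation gint := ((g : set V)°).

Lemma cone0 : (g : set V) 0.
Proof. by have [] : ((g : set V) `&` [set - x | x in g]) 0 by rewrite cone_pointed. Qed.

Lemma coneD x y : (g : set V) x -> (g : set V) y -> (g : set V) (x + y).
Proof.
move=> gx gy.
have h0 : (0 : R) <= 2^-1 by rewrite invr_ge0.
have h1 : (2^-1 : R) <= 1 by rewrite invf_le1 ?ler1n.
have := @cone_convex _ _ g x y (Itv01 h0 h1).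
rewrite !inE => /(_ gx gy) hm.
have := @cone_scale _ _ g 2 _ (ltr0n _ 2) hm; rewrite /conv/=.
rewrite scalerDr !scalerA mulrBr mulr1 mulfV ?pnatr_eq0//.
have -> : (2 : R) - 1 = 1 by rewrite -[2]/(1 + 1)%:R natrD addrK.
by rewrite !scale1r.
Qed.

Lemma cone_int_sub : gint `<=` g.
Proof. exact: interior_subset. Qed.

Lemma cone_intP x (A : set V) : open A -> A `<=` g -> A x -> gint x.
Proof. by move=> oA Ag Ax; rewrite /interior /= nbhsE; exists A. Qed.

Lemma open_translate x (A : set V) : open A -> open [set y | A (y - x)].
Proof.
move=> oA; apply: (@open_comp _ _ (fun y => y - x) A) => // y _.
by apply: (@cvgB _ V) => //; exact: cvg_cst.
Qed.

Lemma cone_intZ (t : R) x : 0 < t -> gint x -> gint (t *: x).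
Proof.
move=> t0 gx; apply: (@cone_intP _ [set y | gint (t^-1 *: y)]).
- apply: (@open_comp _ _ (fun y : V => t^-1 *: y) gint).
    by move=> y _; exact: scaler_continuous.
  exact: open_interior.
- move=> y /= /cone_int_sub /(cone_scale t0).
  by rewrite scalerA mulfV ?gt_eqF// scale1r.
- by rewrite /= scalerA mulVf ?gt_eqF// scale1r.
Qed.

Lemma cone_intD x y : gint x -> (g : set V) y -> gint (x + y).
Proof.
move=> gx gy; apply: (@cone_intP _ [set z | gint (z - y)]).
- by apply: open_translate; exact: open_interior.
- by move=> z /= /cone_int_sub /coneD /(_ gy); rewrite subrK.
- by rewrite /= addrK.
Qed.

Lemma open_minkowski (U A : set V) : open A -> open (U \+m A).
Proof.
move=> oA; have -> : U \+m A = \bigcup_(u in U) [set y | A (y - u)].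
  apply/seteqP; split=> [_ [u Uu [a Aa <-]]|x [u Uu /= Axu]].
    by exists u => //=; rewrite addrAC subrr add0r.
  by exists u => //; exists (x - u) => //; rewrite addrC subrK.
by apply: bigcup_open => u _; exact: open_translate.
Qed.

Lemma minkowski_coneP U :
  U \+m g = U <-> (forall x a, U x -> (g : set V) a -> U (x + a)).
Proof.
split=> [e x a Ux ga|h]; first by rewrite -e; exists x => //; exists a.
apply/seteqP; split=> [_ [x Ux [a ga <-]]|x Ux]; first exact: h.
by exists x => //; exists 0; [exact: cone0|rewrite addr0].
Qed.

Definition gamma_open : set_system V := [set U | open U /\ U \+m g = U].

Fact gamma_openT : gamma_open setT.
Proof. by split; [exact: openT|exact/minkowski_coneP]. Qed.

Fact gamma_openI : setI_closed gamma_open.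
Proof.
move=> U W [oU /minkowski_coneP gU] [oW /minkowski_coneP gW].
split; first exact: openI.
by apply/minkowski_coneP => x a [Ux Wx] ga; split; [exact: gU|exact: gW].
Qed.

Fact gamma_open_bigU (I : Type) (f : I -> set V) :
  (forall i, gamma_open (f i)) -> gamma_open (\bigcup_i f i).
Proof.
move=> gf; split; first by apply: bigcup_open => i _; exact: (gf i).1.
apply/minkowski_coneP => x a [i _ fix_] ga; exists i => //.
by apply: (minkowski_coneP _).1 => //; exact: (gf i).2.
Qed.

Definition cone_le x y := [set x] \+m g `<=` [set y] \+m g.

Definition lower_set : set_system V :=
  [set U | forall x y, cone_le x y -> U y -> U x].

Lemma lower_setE U : lower_set U <-> U \+m g = U.
Proof.
rewrite minkowski_coneP; split=> [lU x a Ux ga|h x y xy Uy].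
  apply: (lU _ x) => // _ [_ -> [b gb <-]].
  by exists x => //; exists (a + b); [exact: coneD|rewrite addrA].
have [] := xy x; first by exists x => //; exists 0; [exact: cone0|rewrite addr0].
by move=> _ -> [a ga <-]; exact: h.
Qed.

Fact lower_setT : lower_set setT.
Proof. by []. Qed.

Fact lower_setI : setI_closed lower_set.
Proof.
by move=> U W lU lW x y xy [Uy Wy]; split; [exact: lU xy _|exact: lW xy _].
Qed.

Fact lower_set_bigU (I : Type) (f : I -> set V) :
  (forall i, lower_set (f i)) -> lower_set (\bigcup_i f i).
Proof. by move=> lf x y xy [i _ fy]; exists i => //; exact: lf xy _. Qed.

HB.instance Definition _ := Choice.on (Vgamma g).
HB.instance Definition _ := @isOpenTopological.Build (Vgamma g) gamma_open
  gamma_openT gamma_openI gamma_open_bigU.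

HB.instance Definition _ := Choice.on (Valex g).
HB.instance Definition _ := @isOpenTopological.Build (Valex g) lower_set
  lower_setT lower_setI lower_set_bigU.

Lemma Vgamma_openE U :
  @open (Vgamma g) U = (@open V U /\ U \+m g = U).
Proof. by []. Qed.

Lemma Valex_openE U : @open (Valex g) U = (U \+m g = U).
Proof. by apply: propext; exact: lower_setE. Qed.

Fact alpha_open U : @open (Valex g) U -> @open (Vgamma g) (U \+m gint).
Proof.
move=> _; rewrite Vgamma_openE; split.
  by apply: open_minkowski; exact: open_interior.
apply/minkowski_coneP => _ a [x Ux [b gb <-]] ga.
by exists x => //; exists (b + a); [exact: cone_intD|rewrite addrA].
Qed.

Fact alpha_mono U W : U `<=` W -> U \+m gint `<=` W \+m gint.
Proof. by move=> UW _ [x Ux [a ga <-]]; exists x; [exact: UW|exists a]. Qed.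

Fact alpha_cap U W : @open (Valex g) U -> @open (Valex g) W ->
  (U \+m gint) `&` (W \+m gint) `<=` (U `&` W) \+m gint.
Proof.
rewrite !Valex_openE => /minkowski_coneP gU /minkowski_coneP gW.
move=> _ [[u Uu [a ga <-]] [w Ww [b gb wb]]].
have cab : a - t *: b @[t --> (0 : R)^'+] --> a - 0 *: b.
  apply: (@cvgB _ V); first exact: cvg_cst.
  apply: cvgZr_tmp; exact: cvg_at_right_filter.
have {}cab : \forall t \near (0 : R)^'+, gint (a - t *: b).
  by apply: (cab gint); rewrite scale0r subr0; exact: open_nbhs_nbhs (conj (open_interior _) ga).
near (0 : R)^'+ => t.
have t0 : 0 < t by near: t; exact: nbhs_right_gt.
have t1 : t < 1 by near: t; exact: nbhs_right_lt.
have abt : gint (a - t *: b) by near: t.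
exists (u + (a - t *: b)); last first.
  by exists (t *: b); [exact: cone_intZ|rewrite addrA subrK].
split; first by apply: gU => //; exact: cone_int_sub.
have -> : u + (a - t *: b) = w + (1 - t) *: b.
  by rewrite addrA -wb scalerBl scale1r addrA.
by apply: gW => //; apply: cone_scale; [rewrite subr_gt0|exact: cone_int_sub].
Unshelve. all: by end_near. Qed.

Fact alpha_cover U (I : Type) (c : I -> set V) :
  U `<=` \bigcup_i c i -> U \+m gint `<=` \bigcup_i (c i \+m gint).
Proof.
move=> Uc _ [x /Uc [i _ cx] [a ga <-]].
by exists i => //; exists x => //; exists a.
Qed.

Definition alpha : site_morphism (Vgamma g) (Valex g) :=
  @SiteMorphism (Vgamma g) (Valex g)
    (fun O => exist _ ((O : set V) \+m gint) (alpha_open (svalP O)))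
    (fun O O' => @alpha_mono O O')
    (fun O O' => @alpha_cap O O' (svalP O) (svalP O'))
    (fun O I c => @alpha_cover O I (fun i => c i)).

Definition beta_map : (Valex g) -> (Vgamma g) := id.

Fact beta_continuous : continuous beta_map.
Proof.
apply/continuousP => U; rewrite Vgamma_openE => -[_ gU].
by rewrite Valex_openE.
Qed.

Definition beta : site_morphism (Valex g) (Vgamma g) := site_of_cts beta_continuous.

Definition is_ephemeral (k : fieldType) (F : Mod k (Valex g)) : Prop :=
  is_zero_ob (direct_image k beta F).
End ConeTopologies.

(* Main.v *)
From Pilot Require Import Defs.
From HB Require Import structures.
From mathcomp Require Import all_boot all_order all_algebra.
From mathcomp Require Import ring_quotient.
From mathcomp Require Import all_classical all_reals all_analysis.
Import Pilot.Defs.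

(** A set U which is open for the usual topology and stable under adding
    vectors of the cone gamma satisfies U + Int(gamma) = U, while any lower set
    U only satisfies U + Int(gamma) <= U.  The inclusions turn restriction of
    sections into natural maps F(U) -> F(U + Int(gamma)) and
    G(U + Int(gamma)) -> G(U), and these are the unit and the counit of an
    adjunction in which the direct image beta_* is left adjoint to alpha_*
    ([alpha_beta_adjunction]).  The counit is invertible, because it compares
    sections over equal open sets.  By uniqueness of left adjoints, alpha^-1 is
    isomorphic to beta_*, and the theorem becomes a statement about beta_*,
    which is given by an explicit formula.

    For any adjunction L -| R with invertible counit, any class W of morphisms
    which L inverts and which contains the components of the unit, the functor
    induced by L on the localization at W is an equivalence: the quasi-inverse
    is R followed by the localization functor, because the unit becomes
    invertible in the localization ([loc_lift_equivalence]).  So two facts on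
    the class W of the morphisms with ephemeral kernel and cokernel remain.

    beta_* inverts W ([beta_inverts]).  Let f be in W and U be gamma-open.  A
    section of F over U killed by f is a section of the kernel, so it vanishes,
    and f is injective over every gamma-open set.  A section t of G over U
    vanishes in the cokernel, so over every cone x + gamma with x in U it is the
    image of some section s_x.  The sets x + Int(gamma) with x in U are
    gamma-open and cover U; the restrictions of the s_x to them agree on
    intersections by injectivity, and they glue to a preimage of t.

    The unit belongs to W ([alpha_beta_unit_ker_coker]).  Over a gamma-open set
    the unit is bijective, so its kernel is ephemeral.  A section of its
    cokernel over U is a coherent family of classes c_x, for x in U, of sections
    over x + Int(gamma) modulo sections over x + gamma.  If U is gamma-open, then
    x lies in y + Int(gamma) for some y in U, and c_x is the restriction of c_y;
    a section representing c_y is defined on y + Int(gamma), which contains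
    x + gamma, so c_x = 0.

    The second fact requires kernels and cokernels to exist.  Kernels of sheaves
    are computed on sections.  For cokernels, the cones x + gamma are the
    smallest open neighbourhoods in the Alexandrov topology, so a cokernel can
    be described by its stalks without sheafification: its sections over U are
    the families of elements of the stalks at the points of U compatible with
    restriction ([coker_homP]). *)

Set Implicit Arguments.
Unset Strict Implicit.
Unset Printing Implicit Defensive.
Import Order.TTheory GRing.Theory Num.Theory numFieldNormedType.Exports.
Local Open Scope classical_set_scope.
Local Open Scope ring_scope.

(** * Submodules, quotients and products of modules *)

Definition mk_linear (k : fieldType) (M N : lmodType k) (f : M -> N)
    (fl : linear f) : {linear M -> N} :=
  HB.pack f (GRing.isLinear.Build k M N *:%R f fl).

(** A Prop-valued closure condition, because membership in the image of a linear
    map between arbitrary modules is not decidable. *)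
Definition submodule_closed (k : fieldType) (M : lmodType k) (P : M -> Prop) :=
  P 0 /\ forall a x y, P x -> P y -> P (a *: x + y).

Section Submodule.
Variables (k : fieldType) (M : lmodType k) (P : M -> Prop).
Hypothesis closedP : submodule_closed P.

(** The closure proof is an argument so that the closed predicate can carry the
    structure of a submodule. *)
Definition submod_pred of submodule_closed P : {pred M} := fun x => `[< P x >].

Lemma submod_predP x : reflect (P x) (x \in submod_pred closedP).
Proof. exact: asboolP. Qed.

Fact submod_pred_closed : submod_closed (submod_pred closedP).
Proof.
split=> [|a x y /submod_predP Px /submod_predP Py]; apply/submod_predP.
  exact: closedP.1.
exact: closedP.2.
Qed.

HB.instance Definition _ :=
  GRing.isSubmodClosed.Build k M (submod_pred closedP) submod_pred_closed.

Record submodule :=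
  Submodule { submod_val : M; _ : submod_val \in submod_pred closedP }.
HB.instance Definition _ := [isSub for submod_val].
HB.instance Definition _ := [Choice of submodule by <:].
HB.instance Definition _ := [SubChoice_isSubLmodule of submodule by <:].

Definition sub_mod : lmodType k := submodule.

Definition sub_incl : {linear sub_mod -> M} :=
  @mk_linear k sub_mod M val (fun a x y => linearP val a x y).

Lemma sub_inclP (x : sub_mod) : P (sub_incl x).
Proof. by apply/submod_predP; exact: (valP (x : submodule)). Qed.

Lemma sub_incl_inj (x y : sub_mod) : sub_incl x = sub_incl y -> x = y.
Proof. by move=> e; apply: val_inj. Qed.

Definition sub_intro (x : M) (Px : P x) : sub_mod :=
  Submodule (introT (submod_predP x) Px).

Section Corestriction.
Variables (M' : lmodType k) (f : {linear M' -> M}).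
Hypothesis fP : forall x, P (f x).

Fact sub_corestr_linear : linear (fun x => sub_intro (fP x)).
Proof.
move=> a x y; apply: sub_incl_inj.
rewrite [LHS](linearP f) [RHS](linearP sub_incl); reflexivity.
Qed.

Definition sub_corestr : {linear M' -> sub_mod} := mk_linear sub_corestr_linear.
End Corestriction.
End Submodule.
Arguments sub_incl {k M P closedP}.

Section QuotientModule.
Variables (k : fieldType) (M : lmodType k) (P : M -> Prop).
Hypothesis closedP : submodule_closed P.

Local Open Scope quotient_scope.
Local Notation quot := (Quotient.quot (submod_pred closedP)).

Definition quot_scale (a : k) : quot -> quot := lift_op1 quot ( *:%R a).

Fact pi_scale (a : k) : {morph \pi_quot : x / a *: x >-> quot_scale a x}.
Proof.
move=> x; unlock quot_scale; apply/eqP; rewrite piE Quotient.equivE.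
by rewrite -scalerBr rpredZ // Quotient.idealrBE reprK.
Qed.

Fact quot_scalerA (a b : k) (x : quot) :
  quot_scale a (quot_scale b x) = quot_scale (a * b) x.
Proof. by rewrite -[x]reprK -!pi_scale scalerA. Qed.

Fact quot_scale1r : left_id 1 quot_scale.
Proof. by move=> x; rewrite -[x]reprK -!pi_scale scale1r. Qed.

Fact quot_scalerDr : right_distributive quot_scale +%R.
Proof.
move=> a x y; rewrite -[x]reprK -[y]reprK -!pi_scale -!raddfD /=.
by rewrite -pi_scale scalerDr.
Qed.

Fact quot_scalerDl (x : quot) : {morph quot_scale^~ x : a b / a + b}.
Proof. by move=> a b; rewrite -[x]reprK -!pi_scale -!raddfD /= scalerDl. Qed.

HB.instance Definition _ := GRing.Zmodule_isLmodule.Build k quot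
  quot_scalerA quot_scale1r quot_scalerDr quot_scalerDl.

Definition quot_mod : lmodType k := quot.

Fact quot_pi_linear : linear (\pi_quot : M -> quot_mod).
Proof. by move=> a x y; rewrite raddfD /= pi_scale. Qed.

Definition quot_pi : {linear M -> quot_mod} := mk_linear quot_pi_linear.

Lemma quot_pi_surj (c : quot_mod) : exists x, quot_pi x = c.
Proof. by exists (repr (c : quot)); exact: reprK. Qed.

Lemma quot_pi_eq x y : quot_pi x = quot_pi y <-> P (x - y).
Proof.
apply: (iff_trans (B := x - y \in submod_pred closedP)).
  by rewrite Quotient.idealrBE; split=> /eqP.
by split=> /submod_predP.
Qed.

Lemma quot_pi_eq0 x : quot_pi x = 0 <-> P x.
Proof. by rewrite -(raddf0 quot_pi) quot_pi_eq subr0. Qed.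

Section Factorization.
Variables (M' : lmodType k) (f : {linear M -> M'}).
Hypothesis fP : forall x, P x -> f x = 0.

Definition quot_lift_fun (c : quot_mod) : M' := f (sval (cid (quot_pi_surj c))).

Lemma quot_lift_funE x : quot_lift_fun (quot_pi x) = f x.
Proof.
rewrite /quot_lift_fun; case: cid => y /= /quot_pi_eq /fP /eqP.
by rewrite raddfB subr_eq0 => /eqP.
Qed.

Fact quot_lift_linear : linear quot_lift_fun.
Proof.
move=> a c d; have [x <-] := quot_pi_surj c; have [y <-] := quot_pi_surj d.
by rewrite -linearP !quot_lift_funE linearP.
Qed.

Definition quot_lift : {linear quot_mod -> M'} := mk_linear quot_lift_linear.

Lemma quot_liftE x : quot_lift (quot_pi x) = f x.
Proof. exact: quot_lift_funE. Qed.
End Factorization.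
End QuotientModule.

Section DependentProduct.
Variables (k : fieldType) (I : Type) (M : I -> lmodType k).

Definition dprod := forall i, M i.
HB.instance Definition _ := gen_eqMixin dprod.
HB.instance Definition _ := gen_choiceMixin dprod.

Let add (c d : dprod) : dprod := fun i => c i + d i.
Let zero : dprod := fun i => 0.
Let opp (c : dprod) : dprod := fun i => - c i.
Let scale (a : k) (c : dprod) : dprod := fun i => a *: c i.

Let ext (c d : dprod) : (forall i, c i = d i) -> c = d.
Proof. exact: functional_extensionality_dep. Qed.

Fact dprod_addA : associative add.
Proof. by move=> *; apply: ext => i; exact: addrA. Qed.
Fact dprod_addC : commutative add.
Proof. by move=> *; apply: ext => i; exact: addrC. Qed.
Fact dprod_add0 : left_id zero add.
Proof. by move=> *; apply: ext => i; exact: add0r. Qed.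
Fact dprod_addN : left_inverse zero opp add.
Proof. by move=> *; apply: ext => i; exact: addNr. Qed.
HB.instance Definition _ := GRing.isZmodule.Build dprod
  dprod_addA dprod_addC dprod_add0 dprod_addN.

Fact dprod_scaleA a b c : scale a (scale b c) = scale (a * b) c.
Proof. by apply: ext => i; exact: scalerA. Qed.
Fact dprod_scale1 : left_id 1 scale.
Proof. by move=> *; apply: ext => i; exact: scale1r. Qed.
Fact dprod_scaleDr : right_distributive scale +%R.
Proof. by move=> *; apply: ext => i; exact: scalerDr. Qed.
Fact dprod_scaleDl c : {morph scale^~ c : a b / a + b}.
Proof. by move=> *; apply: ext => i; exact: scalerDl. Qed.
HB.instance Definition _ := GRing.Zmodule_isLmodule.Build k dprod
  dprod_scaleA dprod_scale1 dprod_scaleDr dprod_scaleDl.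
End DependentProduct.

Lemma ker_closed (k : fieldType) (M N : lmodType k) (f : {linear M -> N}) :
  submodule_closed (fun x => f x = 0).
Proof.
split=> [|a x y fx fy]; first exact: raddf0.
by rewrite linearP fx fy scaler0 addr0.
Qed.

Lemma im_closed (k : fieldType) (M N : lmodType k) (f : {linear M -> N}) :
  submodule_closed (fun y => exists x, f x = y).
Proof.
split=> [|a _ _ [x <-] [y <-]]; first by exists 0; exact: raddf0.
by exists (a *: x + y); rewrite linearP.
Qed.

(** * Isomorphisms and uniqueness of left adjoints *)

Lemma iso_id (C : category) (x : C) : is_iso (idmor x).
Proof. by exists (idmor x); rewrite comp1m. Qed.

Lemma iso_comp (C : category) (x y z : C) (g : mor y z) (f : mor x y) :
  is_iso g -> is_iso f -> is_iso (g \oc f).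
Proof.
move=> [g' [gK Kg]] [f' [fK Kf]]; exists (f' \oc g'); split.
  by rewrite compA -(compA f' g') gK compm1 fK.
by rewrite compA -(compA g f) Kf compm1 Kg.
Qed.

Lemma iso_mono (C : category) (x y z : C) (f : mor y z) (a b : mor x y) :
  is_iso f -> f \oc a = f \oc b -> a = b.
Proof.
move=> [g [gK _]] /(congr1 (mcomp g)).
by rewrite !compA gK !comp1m.
Qed.

Lemma natiso_sym (C D : category) (F G : functor C D) : natiso F G -> natiso G F.
Proof. by move=> [a [b [ab ba]]]; exists b, a. Qed.

Lemma natiso_trans (C D : category) (F G H : functor C D) :
  natiso F G -> natiso G H -> natiso F H.
Proof. by move=> [a ia] [b ib]; exists (b \oc a); apply: iso_comp. Qed.

Lemma nattrans_natiso (C D : category) (F G : functor C D) (a : nattrans F G) :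
  (forall x, is_iso (a x)) -> natiso F G.
Proof.
move=> ia; pose b x := sval (cid (ia x)).
have aK x : b x \oc a x = idmor (F x) by rewrite /b; case: cid => ? [].
have bK x : a x \oc b x = idmor (G x) by rewrite /b; case: cid => ? [].
have bN x y (f : mor x y) : b y \oc fmor G f = fmor F f \oc b x.
  apply: (iso_mono (ia y)); rewrite compA bK comp1m compA ntP -compA bK.
  by rewrite compm1.
exists a, (Nattrans bN).
by split; apply: nattrans_eq => x /=.
Qed.

Section LeftAdjointUnique.
Variables (C D : category) (R : functor D C) (L L' : functor C D).
Variables (adj : adjunction L R) (adj' : adjunction L' R).

Definition left_adjoint_map (x : C) : mor (L x) (L' x) :=
  adj_counit adj (L' x) \oc fmor L (adj_unit adj' x).

Fact left_adjoint_map_natural (x y : C) (f : mor x y) :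
  left_adjoint_map y \oc fmor L f = fmor L' f \oc left_adjoint_map x.
Proof.
rewrite /left_adjoint_map -compA -fmapM.
have /= -> := ntP (adj_unit adj') f.
by rewrite fmapM !compA; congr (_ \oc _); exact: (ntP (adj_counit adj)).
Qed.

Definition left_adjoint_nattrans : nattrans L L' :=
  Nattrans left_adjoint_map_natural.
End LeftAdjointUnique.

(** The comparison maps are mates of the identity of R: by naturality, both
    composites reduce to the triangle identities. *)
Lemma left_adjoint_mapK (C D : category) (R : functor D C) (L L' : functor C D)
    (adj : adjunction L R) (adj' : adjunction L' R) (x : C) :
  left_adjoint_map adj' adj x \oc left_adjoint_map adj adj' x = idmor (L x).
Proof.
rewrite /left_adjoint_map compA.
have /= <- := ntP (adj_counit adj)
  (adj_counit adj' (L x) \oc fmor L' (adj_unit adj x)).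
rewrite -compA -fmapM.
suff -> : fmor R (adj_counit adj' (L x) \oc fmor L' (adj_unit adj x))
    \oc adj_unit adj' x = adj_unit adj x by exact: adj_triangleL.
rewrite fmapM -compA.
have /= <- := ntP (adj_unit adj') (adj_unit adj x).
by rewrite compA adj_triangleR comp1m.
Qed.

Lemma left_adjoint_unique (C D : category) (R : functor D C)
    (L L' : functor C D) :
  adjunction L R -> adjunction L' R -> natiso L L'.
Proof.
move=> adj adj'; apply: (@nattrans_natiso _ _ _ _ (left_adjoint_nattrans adj adj')) => x /=.
by exists (left_adjoint_map adj' adj x); split; exact: left_adjoint_mapK.
Qed.

(** * Localization at morphisms inverted by a left adjoint *)

Section LocalizationUniversal.
Variables (C D : category) (W : forall x y : C, mor x y -> Prop).
Variables (L : functor C D).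
Hypothesis LW : forall (x y : C) (s : mor x y), W s -> is_iso (fmor L s).

Definition fmor_inv (x y : C) (s : mor x y) (Ws : W s) : mor (L y) (L x) :=
  sval (cid (LW Ws)).

Lemma fmor_invK (x y : C) (s : mor x y) (Ws : W s) :
  fmor_inv Ws \oc fmor L s = idmor (L x).
Proof. by rewrite /fmor_inv; case: cid => ? []. Qed.

Lemma fmorK_inv (x y : C) (s : mor x y) (Ws : W s) :
  fmor L s \oc fmor_inv Ws = idmor (L y).
Proof. by rewrite /fmor_inv; case: cid => ? []. Qed.

Fixpoint zeval (x y : C) (p : zigzag W x y) : mor (L x) (L y) :=
  match p with
  | Znil x => idmor (L x)
  | Zfwd _ _ _ f p => zeval p \oc fmor L f
  | Zbwd _ _ _ _ Ws p => zeval p \oc fmor_inv Ws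
  end.

Lemma zeval_cat (x y z : C) (p : zigzag W x y) (q : zigzag W y z) :
  zeval (zcat p q) = zeval q \oc zeval p.
Proof. by elim: p q => /= [? q|*|*]; rewrite ?compm1 // compA; congr (_ \oc _). Qed.

Lemma zeval_zeq (x y : C) (p q : zigzag W x y) : zeq p q -> zeval p = zeval q.
Proof.
elim=> /= [||||||||] *.
- by [].
- by [].
- by congruence.
- by congr (_ \oc _).
- by congr (_ \oc _).
- by rewrite fmap1 compm1.
- by rewrite fmapM compA.
- by rewrite -compA fmor_invK compm1.
- by rewrite -compA fmorK_inv compm1.
Qed.

Lemma zeval_repr (x y : C) (p : zigzag W x y) :
  zeval (loc_repr (loc_class p)) = zeval p.
Proof. by apply/zeval_zeq/loc_classP; exact: loc_reprK. Qed.

Fact loc_lift_1 (x : localization W) :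
  zeval (loc_repr (idmor x)) = idmor (L x).
Proof. exact: zeval_repr. Qed.

Fact loc_lift_M (x y z : localization W) (g : mor y z) (f : mor x y) :
  zeval (loc_repr (g \oc f)) = zeval (loc_repr g) \oc zeval (loc_repr f).
Proof. by rewrite zeval_repr zeval_cat. Qed.

Definition loc_lift : functor (localization W) D :=
  @Functor (localization W) D (fun x => L x) (fun _ _ f => zeval (loc_repr f))
    loc_lift_1 loc_lift_M.

Fact loc_lift_natural (x y : C) (f : mor x y) :
  idmor (L y) \oc fmor (compF loc_lift (localization_functor W)) f =
  fmor L f \oc idmor (L x).
Proof. by rewrite comp1m compm1 /= zeval_repr /= comp1m. Qed.

Lemma loc_liftE : natiso (compF loc_lift (localization_functor W)) L.
Proof.
apply: (@nattrans_natiso _ _ (compF loc_lift (localization_functor W)) L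
  (Nattrans loc_lift_natural)) => x.
exact: iso_id.
Qed.
End LocalizationUniversal.

Lemma loc_functor_iso (C : category) (W : forall x y : C, mor x y -> Prop)
    (x y : C) (s : mor x y) :
  W x y s -> is_iso (fmor (localization_functor W) s).
Proof.
move=> Ws; exists (loc_class (Zbwd Ws (Znil W x))).
by split; rewrite /= loc_compE; apply/loc_classP; constructor.
Qed.

Section ReflectiveLocalization.
Variables (C D : category) (L : functor C D) (R : functor D C).
Variables (adj : adjunction L R) (W : forall x y : C, mor x y -> Prop).
Hypothesis LW : forall (x y : C) (s : mor x y), W s -> is_iso (fmor L s).
Hypothesis unitW : forall x : C, W (adj_unit adj x).
Hypothesis counit_iso : forall y : D, is_iso (adj_counit adj y).

Local Notation Q := (localization_functor W).
Local Notation eta x := (Zfwd (adj_unit adj x) (Znil W _)).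

(** Naturality of the unit in the localization.  For a formal inverse of s it
    follows from naturality at s, since R L s is invertible. *)
Lemma zeq_unit (x y : C) (p : zigzag W x y) :
  zeq (zcat p (eta y)) (Zfwd (adj_unit adj x) (Zfwd (fmor R (zeval LW p)) (Znil W _))).
Proof.
elim: p => {x y} /= [x|x y z f p IH|x y z s Ws p IH].
- apply: Zeq_fwd; apply: Zeq_sym; rewrite fmap1; exact: Zeq_id.
- apply: Zeq_trans (Zeq_fwd _ IH) _.
  apply: Zeq_trans (Zeq_comp _ _ _) _.
  have /= -> := ntP (adj_unit adj) f.
  apply: Zeq_trans (Zeq_sym (Zeq_comp _ _ _)) _.
  apply: Zeq_fwd; apply: Zeq_trans (Zeq_comp _ _ _) _.
  by rewrite fmapM; exact: Zeq_refl.
- apply: Zeq_trans (Zeq_bwd Ws IH) _.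
  (* exposing s as the first step lets the formal inverse cancel it *)
  suff E : zeq (Zfwd (adj_unit adj y)
      (Zfwd (fmor R (zeval LW p)) (Znil W _)))
    (Zfwd s (Zfwd (adj_unit adj x)
      (Zfwd (fmor R (zeval LW p \oc fmor_inv LW Ws)) (Znil W _)))).
    by apply: Zeq_trans (Zeq_bwd Ws E) (Zeq_bwdK _ _).
  apply: Zeq_sym; apply: Zeq_trans (Zeq_comp _ _ _) _.
  have /= -> := ntP (adj_unit adj) s.
  apply: Zeq_trans (Zeq_sym (Zeq_comp _ _ _)) _.
  apply: Zeq_fwd; apply: Zeq_trans (Zeq_comp _ _ _) _.
  by rewrite -fmapM -compA fmor_invK compm1; exact: Zeq_refl.
Qed.

Fact loc_unit_natural (x y : localization W) (f : mor x y) :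
  fmor Q (adj_unit adj y) \oc f =
  fmor (compF (compF Q R) (loc_lift LW)) f \oc fmor Q (adj_unit adj x).
Proof.
rewrite -(loc_reprK f) /= !loc_compE loc_reprK /=.
by apply/loc_classP; exact: zeq_unit.
Qed.

Fact loc_counit_natural (x y : D) (f : mor x y) :
  adj_counit adj y \oc fmor (compF (loc_lift LW) (compF Q R)) f =
  f \oc adj_counit adj x.
Proof. by rewrite /= zeval_repr /= comp1m; exact: (ntP (adj_counit adj)). Qed.

(** A reflective localization inverts its unit, so R followed by the
    localization functor is a quasi-inverse of the induced functor. *)
Lemma loc_lift_equivalence : is_equivalence (loc_lift LW).
Proof.
exists (compF Q R); split.
  apply: natiso_sym.
  apply: (@nattrans_natiso _ _ (idF _) (compF (compF Q R) (loc_lift LW))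
    (@Nattrans _ _ (idF (localization W)) (compF (compF Q R) (loc_lift LW))
     (fun x : localization W => fmor Q (adj_unit adj x)) loc_unit_natural)) => x.
  exact: (loc_functor_iso (unitW x)).
exact: (@nattrans_natiso _ _ (compF (loc_lift LW) (compF Q R)) (idF _)
  (Nattrans loc_counit_natural)).
Qed.
End ReflectiveLocalization.

(** * Sheaves of modules and their kernels *)

Section SheafBasics.
Variables (k : fieldType) (X : topologicalType).
Implicit Types (F G H : Mod k X) (U W : opens X).

Definition hcomp F G (a : mor F G) U :
    {linear sections (sval F) U -> sections (sval G) U} :=
  (a : @nattrans (opcat (opens_cat X)) (modcat k) (sval F) (sval G)) U.

Lemma hcomp_restr F G (a : mor F G) U W (h : U `<=` W) s :
  hcomp a U (restr (sval F) h s) = restr (sval G) h (hcomp a W s).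
Proof.
exact: (congr1 (fun u : {linear _ -> _} => u s)
  (@ntP _ _ _ _ (a : @nattrans (opcat (opens_cat X)) (modcat k) (sval F) (sval G)) W U h)).
Qed.

Lemma hcomp_comp F G H (b : mor G H) (a : mor F G) U s :
  hcomp (b \oc a) U s = hcomp b U (hcomp a U s).
Proof. by rewrite /hcomp /=. Qed.

Lemma hom_ext F G (a b : mor F G) :
  (forall U s, hcomp a U s = hcomp b U s) -> a = b.
Proof. by move=> ab; apply: nattrans_eq => U; apply: linear_eq => s; exact: ab. Qed.

Definition mk_hom F G
    (c : forall U, {linear sections (sval F) U -> sections (sval G) U})
    (cN : forall U W (h : U `<=` W) s,
      c U (restr (sval F) h s) = restr (sval G) h (c W s)) : mor F G :=
  @Nattrans (opcat (opens_cat X)) (modcat k) (sval F) (sval G) c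
    (fun W U h => @linear_eq k _ _ (c U \o restr (sval F) h)
      (restr (sval G) h \o c W) (cN U W h)).

Lemma restr_id (F : presheaf_cat k X) U (h : U `<=` U) s : restr F h s = s.
Proof.
rewrite (Prop_irrelevance h (@subset_refl _ U)).
exact: (congr1 (fun u : {linear _ -> _} => u s)
  (@fmap1 _ _ (F : functor (opcat (opens_cat X)) (modcat k)) U)).
Qed.

Definition mk_presheaf (S : opens X -> lmodType k)
    (r : forall U W, U `<=` W -> {linear S W -> S U})
    (r1 : forall U s, r U U (@subset_refl _ U) s = s)
    (rM : forall (U W Z : opens X) (h : U `<=` W) (g : W `<=` Z) s,
       r U Z (subset_trans h g) s = r U W h (r W Z g s)) : presheaf_cat k X :=
  @Functor (opcat (opens_cat X)) (modcat k) S (fun W U h => r U W h)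
    (fun U => @linear_eq k _ _ (r U U (@subset_refl _ U)) idfun (r1 U))
    (fun Z W U h g => @linear_eq k _ _ (r U Z (subset_trans h g))
      (r U W h \o r W Z g) (rM U W Z h g)).

(** The uniqueness half of the sheaf axiom, for a cover chosen point by point. *)
Lemma sheaf_locality F U (s t : sections (sval F) U) :
  (forall x, (U : set X) x -> exists W (h : W `<=` U),
     (W : set X) x /\ restr (sval F) h s = restr (sval F) h t) -> s = t.
Proof.
move=> loc.
pose c (x : {x | (U : set X) x}) := sval (cid (loc _ (svalP x))).
have cP x : exists h : c x `<=` U,
   (c x : set X) (sval x) /\ restr (sval F) h s = restr (sval F) h t.
  by rewrite /c; case: cid.
have cU x : c x `<=` U by case: (cP x).
have cE x : restr (sval F) (cU x) s = restr (sval F) (cU x) t.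
  by case: (cP x) => h [_]; rewrite (Prop_irrelevance h (cU x)).
have cov : U `<=` \bigcup_x c x.
  by move=> x Ux; exists (exist _ x Ux) => //; case: (cP (exist _ x Ux)) => h [].
have [x y|u [_ u1]] := svalP F U _ c cU cov (fun x => restr (sval F) (cU x) s).
  by rewrite !(restr_comp _ _ (subset_trans (@opensIl _ (c x) (c y)) (cU x))).
by rewrite -(u1 s) // (u1 t).
Qed.

Definition zero_mod : lmodType k := 'rV[k]_0.

Lemma zero_mod_eq (s t : zero_mod) : s = t.
Proof. by apply/rowP; case. Qed.

Definition zero_presheaf : presheaf_cat k X :=
  @mk_presheaf (fun=> zero_mod) (fun _ _ _ => idfun)
    (fun _ _ => erefl) (fun _ _ _ _ _ _ => erefl).

Fact zero_is_sheaf : is_sheaf zero_presheaf.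
Proof.
by move=> U I c cU Uc s _; exists 0; split=> [i|t _]; exact: zero_mod_eq.
Qed.

Definition zero_sheaf : Mod k X := exist _ zero_presheaf zero_is_sheaf.

Definition zero_hom F G : mor F G :=
  @mk_hom F G (fun U => \0) (fun U W h s => esym (raddf0 (restr (sval G) h))).

(** If F is a zero object then its identity equals its zero endomorphism. *)
Lemma zero_obP F : is_zero_ob F <-> forall U (s : sections (sval F) U), s = 0.
Proof.
split=> [[to _] U s|F0].
  have [f f1] := to F.
  have /(congr1 (fun a : mor F F => hcomp a U s)) : idmor F = zero_hom F F.
    by rewrite (f1 (idmor F)) (f1 (zero_hom F F)).
  by [].
split=> G; exists (zero_hom _ _) => g; apply: hom_ext => U s.
  exact: etrans (F0 _ _) (esym (F0 _ _)).
by rewrite (F0 U s) !raddf0.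
Qed.

Lemma zero_homP F G (f : mor F G) :
  is_zero_hom f <-> forall U s, hcomp f U s = 0.
Proof.
split=> [[Z [h [g [/zero_obP Z0 ->]]]] U s|f0].
  by rewrite hcomp_comp (Z0 _ (hcomp g U s)) raddf0.
exists zero_sheaf, (zero_hom _ _), (zero_hom _ _); split.
  by apply/zero_obP => U s; exact: zero_mod_eq.
by apply: hom_ext => U s; rewrite f0.
Qed.

Section Kernel.
Variables (F G : Mod k X) (f : mor F G).

Definition ker_sections U : lmodType k := sub_mod (ker_closed (hcomp f U)).

Fact ker_restr_subproof U W (h : U `<=` W) (s : ker_sections W) :
  hcomp f U ((restr (sval F) h \o sub_incl) s) = 0.
Proof. by rewrite /= hcomp_restr (sub_inclP s) raddf0. Qed.

Definition ker_restr U W (h : U `<=` W) :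
    {linear ker_sections W -> ker_sections U} :=
  sub_corestr (ker_closed (hcomp f U)) (ker_restr_subproof h).

Fact ker_restr1 U (s : ker_sections U) : ker_restr (@subset_refl _ U) s = s.
Proof. by apply: sub_incl_inj; exact: restr_id. Qed.

Fact ker_restrM (U W Z : opens X) (h : U `<=` W) (g : W `<=` Z)
    (s : ker_sections Z) :
  ker_restr (subset_trans h g) s = ker_restr h (ker_restr g s).
Proof. by apply: sub_incl_inj; apply/esym; exact: restr_comp. Qed.

Definition ker_presheaf : presheaf_cat k X := mk_presheaf ker_restr1 ker_restrM.

Fact ker_is_sheaf : is_sheaf ker_presheaf.
Proof.
move=> U I c cU Uc s ss.
have [i j|t [tP t1]] := svalP F U I c cU Uc (fun i => sub_incl (s i)).
  exact: (congr1 sub_incl (ss i j)).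
have ft : hcomp f U t = 0.
  apply: sheaf_locality => x /Uc[i _ cx]; exists (c i), (cU i); split=> //.
  by rewrite -hcomp_restr tP raddf0; exact: (sub_inclP (s i)).
exists (sub_intro (ker_closed (hcomp f U)) ft); split=> [i|t' t'P].
  by apply: sub_incl_inj; exact: tP.
apply: sub_incl_inj; apply: t1 => i.
exact: (congr1 sub_incl (t'P i)).
Qed.

Definition ker_sheaf : Mod k X := exist _ ker_presheaf ker_is_sheaf.

Definition ker_hom : mor ker_sheaf F :=
  @mk_hom ker_sheaf F (fun U => sub_incl)
    (fun _ _ _ _ => erefl).

Lemma ker_homP : is_kernel f ker_hom.
Proof.
split=> [|T g /zero_homP fg0].
  by apply/zero_homP => U s; rewrite hcomp_comp; exact: (sub_inclP s).
have fg_eq0 U s : hcomp f U (hcomp g U s) = 0 by rewrite -hcomp_comp.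
pose c U := sub_corestr (ker_closed (hcomp f U)) (f := hcomp g U) (fg_eq0 U).
have cN U W (h : U `<=` W) s :
    c U (restr (sval T) h s) = restr (sval ker_sheaf) h (c W s).
  by apply: sub_incl_inj; exact: hcomp_restr.
exists (@mk_hom T ker_sheaf c cN); split; first exact: hom_ext.
move=> h hg; apply: hom_ext => U s; apply: sub_incl_inj.
exact/esym/(congr1 (fun a : mor T F => hcomp a U s) hg).
Qed.
End Kernel.
End SheafBasics.

(** The inverse bijections are linear and commute with restrictions because f
    does and is injective. *)
Lemma hom_bij_iso (k : fieldType) (X : topologicalType) (F G : Mod k X)
    (f : mor F G) :
  (forall U s, hcomp f U s = 0 -> s = 0) ->
  (forall U t, exists s, hcomp f U s = t) -> is_iso f.
Proof.
move=> f_inj f_surj.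
have inj U s s' : hcomp f U s = hcomp f U s' -> s = s'.
  move=> e; apply/eqP; rewrite -subr_eq0; apply/eqP/(f_inj U).
  by rewrite linearB /= e subrr.
pose c U t := sval (cid (f_surj U t)).
have cE U t : hcomp f U (c U t) = t by rewrite /c; case: cid.
have cL U : linear (c U).
  by move=> a s t; apply: inj; rewrite linearP !cE.
have cN (U W : opens X) (h : U `<=` W) s :
    mk_linear (cL U) (restr (sval G) h s) =
    restr (sval F) h (mk_linear (cL W) s).
  apply: inj; rewrite hcomp_restr [LHS]cE.
  exact: (congr1 (restr (sval G) h) (esym (cE W s))).
exists (@mk_hom _ _ G F (fun U => mk_linear (cL U)) cN).
split; apply: hom_ext => U s; rewrite hcomp_comp; last exact: cE.
by apply: inj; exact: cE.
Qed.

(** * Cokernels on a space whose points have smallest neighbourhoods *)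

(** Every point x has a smallest open neighbourhood m x, so the stalk of a sheaf
    at x is its module of sections over m x. *)
Section AlexandrovCokernel.
Variables (k : fieldType) (X : topologicalType) (m : X -> opens X).
Hypothesis m_mem : forall x, (m x : set X) x.
Hypothesis m_min : forall (U : opens X) x, (U : set X) x -> m x `<=` U.
Variables (F G : Mod k X) (f : mor F G).
Implicit Types (U W : opens X).

Definition coker_stalk (x : X) : lmodType k :=
  quot_mod (im_closed (hcomp f (m x))).

Definition stalk_pi (x : X) : {linear sections (sval G) (m x) -> coker_stalk x} :=
  quot_pi (im_closed (hcomp f (m x))).

Lemma stalk_pi_eq0 x t : stalk_pi x t = 0 <-> exists s, hcomp f (m x) s = t.
Proof. exact: quot_pi_eq0. Qed.

Lemma stalk_pi_surj x (c : coker_stalk x) : exists t, stalk_pi x t = c.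
Proof. exact: quot_pi_surj. Qed.

Fact stalk_restr_subproof x y (xy : (m x : set X) y) t :
  (exists s, hcomp f (m x) s = t) ->
  (stalk_pi y \o restr (sval G) (m_min xy)) t = 0.
Proof.
move=> [s <-]; apply/stalk_pi_eq0; exists (restr (sval F) (m_min xy) s).
exact: hcomp_restr.
Qed.

(** When y is in m x, the set m y is contained in m x and restriction of sections
    passes to the stalks of the cokernel. *)
Definition stalk_restr x y (xy : (m x : set X) y) :
    {linear coker_stalk x -> coker_stalk y} :=
  quot_lift (im_closed (hcomp f (m x))) (@stalk_restr_subproof x y xy).

Lemma stalk_restrE x y (xy : (m x : set X) y) t :
  stalk_restr xy (stalk_pi x t) = stalk_pi y (restr (sval G) (m_min xy) t).
Proof. exact: quot_liftE. Qed.

Definition coset_families U : lmodType k :=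
  dprod (fun x : {x | (U : set X) x} => coker_stalk (sval x)).

Definition coherent U (c : coset_families U) :=
  forall x y (xy : (m (sval x) : set X) (sval y)), stalk_restr xy (c x) = c y.

Lemma coherent_closed U : submodule_closed (@coherent U).
Proof.
split=> [x y xy|a c d cc cd x y xy]; first exact: raddf0.
have -> : (a *: c + d) x = a *: c x + d x by [].
by rewrite linearP cc cd.
Qed.

Definition coker_sections U : lmodType k := sub_mod (@coherent_closed U).

Definition coset U (c : coker_sections U) x (Ux : (U : set X) x) : coker_stalk x :=
  (sub_incl c : coset_families U) (exist _ x Ux).

Lemma coset_ext U (c d : coker_sections U) :
  (forall x (Ux : (U : set X) x), coset c Ux = coset d Ux) -> c = d.
Proof.
move=> cd; apply: sub_incl_inj; apply: functional_extensionality_dep => -[x Ux].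
exact: cd.
Qed.

Lemma cosetP U a (c d : coker_sections U) x (Ux : (U : set X) x) :
  coset (a *: c + d) Ux = a *: coset c Ux + coset d Ux.
Proof. by rewrite /coset linearP. Qed.

Lemma coset0 U x (Ux : (U : set X) x) : coset (0 : coker_sections U) Ux = 0.
Proof. by rewrite /coset raddf0. Qed.

Lemma coset_coherent U (c : coker_sections U) x y (Ux : (U : set X) x)
    (Uy : (U : set X) y) (xy : (m x : set X) y) :
  stalk_restr xy (coset c Ux) = coset c Uy.
Proof. exact: (sub_inclP c (exist _ x Ux) (exist _ y Uy) xy). Qed.

Section MakeSection.
Variables (U : opens X) (c : forall x, (U : set X) x -> coker_stalk x).
Hypothesis cP : forall x y (Ux : (U : set X) x) (Uy : (U : set X) y)
  (xy : (m x : set X) y), stalk_restr xy (c Ux) = c Uy.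

Definition mk_coker_section : coker_sections U :=
  @sub_intro _ _ _ (@coherent_closed U) (fun x => c (proj2_sig x))
    (fun x y xy => cP (proj2_sig x) (proj2_sig y) xy).

Lemma mk_cosetE x (Ux : (U : set X) x) : coset mk_coker_section Ux = c Ux.
Proof. by []. Qed.
End MakeSection.

Definition coker_restr_fun U W (h : U `<=` W) (c : coker_sections W) :
    coker_sections U :=
  mk_coker_section (fun x y Ux Uy xy => coset_coherent c (h x Ux) (h y Uy) xy).

Fact coker_restr_linear U W (h : U `<=` W) : linear (coker_restr_fun h).
Proof.
by move=> a c d; apply: coset_ext => x Ux; rewrite cosetP !mk_cosetE cosetP.
Qed.

Definition coker_restr U W (h : U `<=` W) :
    {linear coker_sections W -> coker_sections U} :=
  mk_linear (coker_restr_linear h).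

Lemma coset_irr U (c : coker_sections U) x (Ux Ux' : (U : set X) x) :
  coset c Ux = coset c Ux'.
Proof. by rewrite (Prop_irrelevance Ux Ux'). Qed.

Fact coker_restr1 U c : coker_restr (@subset_refl _ U) c = c.
Proof.
apply: coset_ext => x Ux.
exact: (coset_irr c (@subset_refl _ U x Ux) Ux).
Qed.

Fact coker_restrM (U W Z : opens X) (h : U `<=` W) (g : W `<=` Z) c :
  coker_restr (subset_trans h g) c = coker_restr h (coker_restr g c).
Proof.
apply: coset_ext => x Ux.
exact: (coset_irr c (subset_trans h g Ux) (g x (h x Ux))).
Qed.

Definition coker_presheaf : presheaf_cat k X :=
  mk_presheaf coker_restr1 coker_restrM.

Lemma coset_restr U W (h : U `<=` W) (c : sections coker_presheaf W)
    x (Ux : (U : set X) x) :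
  coset (restr coker_presheaf h c : coker_sections U) Ux =
  coset (c : coker_sections W) (h x Ux).
Proof. by []. Qed.

(** A section is a family indexed by points subject to conditions relating x to
    the points of m x only, so coherent families glue. *)
Fact coker_is_sheaf : is_sheaf coker_presheaf.
Proof.
move=> U I c cU Uc s ss.
have sE i j x (xi : (c i : set X) x) (xj : (c j : set X) x) :
    coset (s i : coker_sections _) xi = coset (s j : coker_sections _) xj.
  have xij : (opensI (c i) (c j) : set X) x by [].
  have := congr1 (fun t : coker_sections _ => coset t xij) (ss i j).
  rewrite !coset_restr => e.
  rewrite (coset_irr _ xi (@opensIl _ (c i) (c j) x xij)) e.
  exact: coset_irr.
have ix x : (U : set X) x -> {i | (c i : set X) x}.
  by move=> /Uc cx; apply: cid; case: cx => i; exists i.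
pose t x (Ux : (U : set X) x) :=
  coset (s (sval (ix x Ux)) : coker_sections _) (svalP (ix x Ux)).
have tE i x (Ux : (U : set X) x) (xi : (c i : set X) x) :
  t x Ux = coset (s i : coker_sections _) xi by exact: sE.
have tP x y (Ux : (U : set X) x) (Uy : (U : set X) y) (xy : (m x : set X) y) :
    stalk_restr xy (t x Ux) = t y Uy.
  have xi := svalP (ix x Ux); have yi := m_min xi xy.
  by rewrite (tE _ _ Ux xi) (tE _ _ Uy yi); exact: coset_coherent.
exists (mk_coker_section tP); split=> [i|t' t'P]; apply: coset_ext => x Ux.
  by rewrite coset_restr mk_cosetE; exact: tE.
have xi := svalP (ix x Ux).
rewrite mk_cosetE (tE _ _ Ux xi) -t'P coset_restr.
exact: coset_irr.
Qed.

Definition coker_sheaf : Mod k X := exist _ coker_presheaf coker_is_sheaf.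

Fact coker_map_coherent U (t : sections (sval G) U) x y (Ux : (U : set X) x)
    (Uy : (U : set X) y) (xy : (m x : set X) y) :
  stalk_restr xy (stalk_pi x (restr (sval G) (m_min Ux) t)) =
  stalk_pi y (restr (sval G) (m_min Uy) t).
Proof. by rewrite stalk_restrE (restr_comp _ _ (m_min Uy)). Qed.

Definition coker_map_fun U (t : sections (sval G) U) : coker_sections U :=
  mk_coker_section (coker_map_coherent t).

Fact coker_map_linear U : linear (@coker_map_fun U).
Proof.
by move=> a s t; apply: coset_ext => x Ux; rewrite cosetP !mk_cosetE !linearP.
Qed.

Fact coker_map_natural U W (h : U `<=` W) s :
  mk_linear (@coker_map_linear U) (restr (sval G) h s) =
  restr coker_presheaf h (mk_linear (@coker_map_linear W) s).
Proof.
apply: coset_ext => x Ux; rewrite coset_restr !mk_cosetE.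
by rewrite (restr_comp _ _ (m_min (h x Ux))).
Qed.

Definition coker_hom : mor G coker_sheaf :=
  @mk_hom _ _ G coker_sheaf (fun U => mk_linear (@coker_map_linear U))
    coker_map_natural.

Lemma coset_coker_hom U t x (Ux : (U : set X) x) :
  coset (hcomp coker_hom U t : coker_sections U) Ux =
  stalk_pi x (restr (sval G) (m_min Ux) t).
Proof. by []. Qed.

(** A section of G vanishes in the cokernel when it is locally in the image of
    f, and here locally means over the smallest neighbourhoods. *)
Lemma coker_hom_eq0 U t : hcomp coker_hom U t = 0 ->
  forall x (Ux : (U : set X) x),
    exists s, hcomp f (m x) s = restr (sval G) (m_min Ux) t.
Proof.
by move=> t0 x Ux; apply/stalk_pi_eq0; rewrite -coset_coker_hom t0 coset0.
Qed.

(** Sections of the cokernel lift to G locally: on m x, coherence determines the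
    whole family by its element at x. *)
Lemma coker_section_stalk U (c : sections coker_presheaf U) x (Ux : (U : set X) x) :
  exists u, coset (c : coker_sections U) Ux = stalk_pi x u /\
    restr coker_presheaf (m_min Ux) c = hcomp coker_hom (m x) u.
Proof.
have [u uE] := stalk_pi_surj (coset (c : coker_sections U) Ux).
exists u; split=> //; apply: coset_ext => y xy.
rewrite coset_restr coset_coker_hom -(coset_coherent c Ux _ xy) -uE.
exact: stalk_restrE.
Qed.

Lemma coker_hom_comp : is_zero_hom (coker_hom \oc f).
Proof.
apply/zero_homP => U s; apply: coset_ext => x Ux.
rewrite hcomp_comp.
rewrite coset_coker_hom coset0; apply/stalk_pi_eq0.
by exists (restr (sval F) (m_min Ux) s); exact: hcomp_restr.
Qed.

Section Factorization.
Variables (T : Mod k X) (g : mor G T).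
Hypothesis gf0 : is_zero_hom (g \oc f).

Fact stalk_fact_subproof x t : (exists s, hcomp f (m x) s = t) -> hcomp g (m x) t = 0.
Proof. by move=> [s <-]; rewrite -hcomp_comp; exact: ((zero_homP _).1 gf0). Qed.

Definition stalk_fact x : {linear coker_stalk x -> sections (sval T) (m x)} :=
  quot_lift (im_closed (hcomp f (m x))) (@stalk_fact_subproof x).

Lemma stalk_factE x t : stalk_fact x (stalk_pi x t) = hcomp g (m x) t.
Proof. exact: quot_liftE. Qed.

Lemma stalk_fact_restr x y (xy : (m x : set X) y) c :
  restr (sval T) (m_min xy) (stalk_fact x c) = stalk_fact y (stalk_restr xy c).
Proof.
have [t <-] := stalk_pi_surj c.
by rewrite stalk_restrE !stalk_factE hcomp_restr.
Qed.

(** The maps induced on stalks by g send a coherent family to a compatible family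
    of sections of T over the sets m x, which cover U. *)
Lemma coker_glue U (c : coker_sections U) :
  exists t : sections (sval T) U, forall x (Ux : (U : set X) x),
    restr (sval T) (m_min Ux) t = stalk_fact x (coset c Ux).
Proof.
pose I := {x | (U : set X) x}.
have cov : U `<=` \bigcup_(i : I) m (sval i) by move=> x Ux; exists (exist _ x Ux).
have [i j|t [tP _]] := svalP T U I (fun i => m (sval i))
    (fun i => m_min (proj2_sig i)) cov
    (fun i => stalk_fact (sval i) (coset c (proj2_sig i))).
  apply: sheaf_locality => z [zi zj].
  have h : m z `<=` opensI (m (sval i)) (m (sval j)) by apply: m_min.
  exists (m z), h; split=> //.
  rewrite (restr_comp _ _ (m_min zi)) (restr_comp _ _ (m_min zj)).
  have Uz : (U : set X) z by exact: (m_min (svalP i)).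
  by rewrite !stalk_fact_restr !(coset_coherent _ _ Uz).
by exists t => x Ux; exact: (tP (exist _ x Ux)).
Qed.

Definition coker_fact_fun U (c : coker_sections U) : sections (sval T) U :=
  sval (cid (coker_glue c)).

Lemma coker_fact_funE U (c : coker_sections U) x (Ux : (U : set X) x) :
  restr (sval T) (m_min Ux) (coker_fact_fun c) = stalk_fact x (coset c Ux).
Proof. by rewrite /coker_fact_fun; case: cid. Qed.

Lemma restr_m_ext U (s t : sections (sval T) U) :
  (forall x (Ux : (U : set X) x),
     restr (sval T) (m_min Ux) s = restr (sval T) (m_min Ux) t) -> s = t.
Proof.
by move=> st; apply: sheaf_locality => x Ux; exists (m x), (m_min Ux).
Qed.

Fact coker_fact_linear U : linear (@coker_fact_fun U).
Proof.
move=> a c d; apply: restr_m_ext => x Ux.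
by rewrite linearP !coker_fact_funE cosetP linearP.
Qed.

Fact coker_fact_natural U W (h : U `<=` W) c :
  mk_linear (@coker_fact_linear U) (restr coker_presheaf h c) =
  restr (sval T) h (mk_linear (@coker_fact_linear W) c).
Proof.
apply: restr_m_ext => x Ux; rewrite (restr_comp _ _ (m_min (h x Ux))).
by rewrite [LHS]coker_fact_funE [RHS]coker_fact_funE.
Qed.

Definition coker_fact : mor coker_sheaf T :=
  @mk_hom _ _ coker_sheaf T (fun U => mk_linear (@coker_fact_linear U))
    coker_fact_natural.

Lemma coker_factK : coker_fact \oc coker_hom = g.
Proof.
apply: hom_ext => U s; apply: restr_m_ext => x Ux.
rewrite hcomp_comp [LHS]coker_fact_funE coset_coker_hom stalk_factE.
exact: hcomp_restr.
Qed.
End Factorization.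

Lemma coker_homP : is_cokernel f coker_hom.
Proof.
split=> [|T g gf0]; first exact: coker_hom_comp.
exists (coker_fact gf0); split; first exact: coker_factK.
move=> h hg; apply: hom_ext => U c; apply: restr_m_ext => x Ux.
have [u [cu uE]] := coker_section_stalk c Ux.
rewrite [LHS]coker_fact_funE cu stalk_factE -hcomp_restr uE.
by rewrite -hcomp_comp hg.
Qed.
End AlexandrovCokernel.

(** * The adjunction between beta and alpha *)

Section Cone.
Variables (R : realType) (V : normedVectType R) (g : proper_cone V).

Local Notation "A \+m B" := (minkowski_sum A B) (at level 50).
Local Notation gint := ((g : set V)°).

Fact cone_translate_open (x : Valex g) : @open (Valex g) ([set x : V] \+m g).
Proof.
rewrite Valex_openE; apply/minkowski_coneP => _ a [_ -> [b gb <-]] ga.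
by exists x => //; exists (b + a); [exact: coneD|rewrite addrA].
Qed.

Definition cone_translate (x : Valex g) : opens (Valex g) :=
  exist _ ([set x : V] \+m g) (@cone_translate_open x).

Lemma cone_translate_mem x : (cone_translate x : set V) x.
Proof. by exists x => //; exists 0; [exact: cone0|rewrite addr0]. Qed.

Lemma cone_translate_min (U : opens (Valex g)) x :
  (U : set V) x -> cone_translate x `<=` U.
Proof.
have := svalP U; rewrite Valex_openE => /minkowski_coneP gU Ux.
by move=> _ [_ -> [a ga <-]]; exact: gU.
Qed.

(** This gives U <= U + Int(gamma) for U open: move x slightly in the direction
    opposite to an interior vector of the cone. *)
Lemma open_sub_cone_int (U : set V) x : open U -> U x ->
  exists y a, [/\ U y, gint a & y + a = x].
Proof.
move=> oU Ux; have [a ga] := @cone_int _ _ g.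
have cxa : x - t *: a @[t --> (0 : R)^'+] --> x - 0 *: a.
  apply: (@cvgB _ V); first exact: cvg_cst.
  by apply: cvgZr_tmp; exact: cvg_at_right_filter.
have {}cxa : \forall t \near (0 : R)^'+, U (x - t *: a).
  by apply: (cxa U); rewrite scale0r subr0; exact: open_nbhs_nbhs (conj oU Ux).
near (0 : R)^'+ => t.
exists (x - t *: a), (t *: a); split; last by rewrite subrK.
  by near: t.
by apply: cone_intZ => //; near: t; exact: nbhs_right_gt.
Unshelve. all: by end_near. Qed.

Lemma alpha_sub (U : opens (Valex g)) : beta g (alpha g U) `<=` U.
Proof.
have := svalP U; rewrite Valex_openE => /minkowski_coneP gU.
move=> z [x Ux [a ga xaz]]; have <- : x + a = z := xaz.
by apply: gU => //; exact: cone_int_sub.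
Qed.

Lemma sub_alpha (U : opens (Vgamma g)) : U `<=` alpha g (beta g U).
Proof.
move=> x Ux; have [oU _] := svalP U.
have [y [a [Uy ga <-]]] := open_sub_cone_int oU Ux.
by exists y => //; exists a.
Qed.

Lemma sub_beta_alpha (U : opens (Vgamma g)) :
  beta g U `<=` beta g (alpha g (beta g U)).
Proof. exact: sub_alpha. Qed.

Lemma alpha_beta_sub (U : opens (Vgamma g)) : alpha g (beta g U) `<=` U.
Proof. exact: (@alpha_sub (beta g U)). Qed.

Variable k : fieldType.

Local Notation A := (direct_image k (alpha g)).
Local Notation B := (direct_image k (beta g)).

Fact alpha_beta_unit_restr (F : Mod k (Valex g)) (U W : opens (Valex g))
    (h : U `<=` W) s :
  restr (sval F) (@alpha_sub U) (restr (sval F) h s) =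
  restr (sval (A (B F))) h (restr (sval F) (@alpha_sub W) s).
Proof.
rewrite [RHS](restr_comp _ _ (subset_trans (@alpha_sub U) h)).
exact: restr_comp.
Qed.

Definition alpha_beta_unit_hom (F : Mod k (Valex g)) : mor F (A (B F)) :=
  @mk_hom _ _ F (A (B F)) (fun U => restr (sval F) (@alpha_sub U))
    (@alpha_beta_unit_restr F).

Lemma alpha_beta_unit_homE F U s :
  hcomp (alpha_beta_unit_hom F) U s = restr (sval F) (@alpha_sub U) s.
Proof. by []. Qed.

Fact alpha_beta_unit_natural (F F' : Mod k (Valex g)) (f : mor F F') :
  alpha_beta_unit_hom F' \oc f = fmor (compF A B) f \oc alpha_beta_unit_hom F.
Proof.
apply: hom_ext => U s; rewrite !hcomp_comp.
exact: esym (hcomp_restr f (@alpha_sub U) s).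
Qed.

Definition alpha_beta_unit : nattrans (idF _) (compF A B) :=
  @Nattrans _ _ (idF _) (compF A B) alpha_beta_unit_hom alpha_beta_unit_natural.

Fact alpha_beta_counit_restr (G : Mod k (Vgamma g)) (U W : opens (Vgamma g))
    (h : U `<=` W) s :
  restr (sval G) (@sub_alpha U) (restr (sval (B (A G))) h s) =
  restr (sval G) h (restr (sval G) (@sub_alpha W) s).
Proof.
rewrite [RHS](restr_comp _ _ (subset_trans h (@sub_alpha W))).
exact: restr_comp.
Qed.

Definition alpha_beta_counit_hom (G : Mod k (Vgamma g)) : mor (B (A G)) G :=
  @mk_hom _ _ (B (A G)) G (fun U => restr (sval G) (@sub_alpha U))
    (@alpha_beta_counit_restr G).

Fact alpha_beta_counit_natural (G G' : Mod k (Vgamma g)) (f : mor G G') :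
  alpha_beta_counit_hom G' \oc fmor (compF B A) f = f \oc alpha_beta_counit_hom G.
Proof.
apply: hom_ext => U s; rewrite !hcomp_comp.
exact: esym (hcomp_restr f (@sub_alpha U) s).
Qed.

Definition alpha_beta_counit : nattrans (compF B A) (idF _) :=
  @Nattrans _ _ (compF B A) (idF _) alpha_beta_counit_hom alpha_beta_counit_natural.

Fact alpha_beta_triangleL (F : Mod k (Valex g)) :
  alpha_beta_counit (B F) \oc fmor B (alpha_beta_unit F) = idmor (B F).
Proof.
apply: hom_ext => U s; rewrite hcomp_comp.
exact: etrans (restr_comp _ _ (@subset_refl _ (beta g U)) _) (restr_id _ _).
Qed.

Fact alpha_beta_triangleR (G : Mod k (Vgamma g)) :
  fmor A (alpha_beta_counit G) \oc alpha_beta_unit (A G) = idmor (A G).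
Proof.
apply: hom_ext => U s; rewrite hcomp_comp.
exact: etrans (restr_comp _ _ (@subset_refl _ (alpha g U)) _) (restr_id _ _).
Qed.

Definition alpha_beta_adjunction : adjunction B A :=
  @Adjunction _ _ B A alpha_beta_unit alpha_beta_counit
    alpha_beta_triangleL alpha_beta_triangleR.

(** The counit restricts sections along an equality of open sets. *)
Lemma alpha_beta_counit_iso (G : Mod k (Vgamma g)) :
  is_iso (adj_counit alpha_beta_adjunction G).
Proof.
apply: hom_bij_iso => U.
  move=> s s0; rewrite -(restr_id (@subset_refl _ (alpha g (beta g U))) s).
  rewrite -(restr_comp (@alpha_beta_sub U) (@sub_alpha U)).
  by rewrite [X in restr _ _ X]s0 raddf0.
move=> t; exists (restr (sval G) (@alpha_beta_sub U) t).
exact: etrans (restr_comp _ _ (@subset_refl _ U) _) (restr_id _ _).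
Qed.

Lemma ephemeralP (F : Mod k (Valex g)) :
  is_ephemeral F <->
  forall (U : opens (Vgamma g)) (s : sections (sval F) (beta g U)), s = 0.
Proof. exact: zero_obP. Qed.

(** * Morphisms with ephemeral kernel and cokernel *)

Section EphemeralKernelCokernel.
Variables (F G : Mod k (Valex g)) (f : mor F G).

(** The section s lies in the explicit kernel sheaf, which factors through K,
    and K has no section over U. *)
Lemma ker_ephemeral_inj (K : Mod k (Valex g)) (i : mor K F) :
  is_kernel f i -> is_ephemeral K ->
  forall (U : opens (Vgamma g)) s, hcomp f (beta g U) s = 0 -> s = 0.
Proof.
move=> [_ univ] /ephemeralP K0 U s fs0.
have [h [hE _]] := univ _ (ker_hom f) (ker_homP f).1.
pose s' : sections (sval (ker_sheaf f)) (beta g U) :=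
  sub_intro (ker_closed (hcomp f (beta g U))) fs0.
have -> : s = hcomp (ker_hom f) (beta g U) s' by [].
rewrite -hE hcomp_comp.
by rewrite (K0 U (hcomp h _ s')) raddf0.
Qed.

(** The explicit cokernel map factors through C, so it kills t. *)
Lemma coker_ephemeral_local_surj (C : Mod k (Valex g)) (p : mor G C) :
  is_cokernel f p -> is_ephemeral C ->
  forall (U : opens (Vgamma g)) (t : sections (sval G) (beta g U)) x
    (Ux : (beta g U : set V) x),
  exists s, hcomp f (cone_translate x) s =
    restr (sval G) (@cone_translate_min (beta g U) x Ux) t.
Proof.
move=> [_ univ] /ephemeralP C0 U t.
have [h [hE _]] := univ _ (coker_hom cone_translate_min f)
  (coker_hom_comp cone_translate_min f).
suff qt0 : hcomp (coker_hom cone_translate_min f) (beta g U) t = 0.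
  by move=> x Ux; exact: (coker_hom_eq0 qt0 Ux).
rewrite -hE hcomp_comp.
by rewrite (C0 U (hcomp p _ t)) raddf0.
Qed.
End EphemeralKernelCokernel.

(** Injectivity over gamma-open sets is what lets the local preimages of a section
    be glued: they live over the cones x + gamma, which need not be gamma-open,
    and become unique after restriction to x + Int(gamma). *)
Lemma beta_inverts (F G : Mod k (Valex g)) (f : mor F G) :
  ker_coker_in (fun H : Mod k (Valex g) => is_ephemeral H) f ->
  is_iso (fmor B f).
Proof.
move=> [[K [incl [Kincl K0]]] [C [p [Cp C0]]]].
have f_inj := ker_ephemeral_inj Kincl K0.
have f_inj2 (U : opens (Vgamma g)) s s' :
    hcomp f (beta g U) s = hcomp f (beta g U) s' -> s = s'.
  move=> e; apply/eqP; rewrite -subr_eq0; apply/eqP/f_inj.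
  by rewrite linearB /= e subrr.
apply: hom_bij_iso => [|U t]; first exact: f_inj.
have loc := coker_ephemeral_local_surj Cp C0 (t : sections (sval G) (beta g U)).
pose I := {x | (beta g U : set V) x}.
(* c x is x + Int(gamma), since gamma + Int(gamma) = Int(gamma) *)
pose c (x : I) : opens (Vgamma g) := alpha g (cone_translate (sval x)).
have cx (x : I) : beta g (c x) `<=` cone_translate (sval x) by exact: alpha_sub.
have cU (x : I) : c x `<=` U.
  by apply: subset_trans (cx x) _; exact: (cone_translate_min (proj2_sig x)).
have cov : U `<=` \bigcup_x c x.
  move=> x Ux; have [oU _] := svalP U.
  have [y [a [Uy ga <-]]] := open_sub_cone_int oU Ux.
  exists (exist _ y Uy) => //; exists y; first exact: cone_translate_mem.
  by exists a.
pose s0 (x : I) := sval (cid (loc _ (proj2_sig x))).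
have s0E x : hcomp f _ (s0 x) =
    restr (sval G) (@cone_translate_min (beta g U) _ (proj2_sig x)) t.
  by rewrite /s0; case: cid.
pose s (x : I) : sections (sval (B F)) (c x) := restr (sval F) (cx x) (s0 x).
have sE x : hcomp f (beta g (c x)) (s x) = restr (sval (B G)) (cU x) t.
  rewrite /s hcomp_restr s0E; exact: restr_comp.
have [x y|S [SP _]] := svalP (B F) U I c cU cov s.
  apply: (f_inj2 (opensI (c x) (c y))).
  rewrite [LHS](hcomp_restr f) [RHS](hcomp_restr f) !sE.
  rewrite [LHS](restr_comp _ _ (subset_trans (@opensIl _ (c x) (c y)) (cU x))).
  exact/esym/restr_comp.
exists S; apply: sheaf_locality => x /cov[i _ ci]; exists (c i), (cU i).
split=> //; rewrite -hcomp_restr SP; exact: sE.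
Qed.

(** The kernel is ephemeral because sections over U and over U + Int(gamma) agree
    for U gamma-open.  The cokernel is ephemeral because a class at a point x of U
    comes from a point y of U with x - y in the interior of the cone. *)
Lemma alpha_beta_unit_ker_coker (F : Mod k (Valex g)) :
  ker_coker_in (fun H : Mod k (Valex g) => is_ephemeral H)
    (adj_unit alpha_beta_adjunction F).
Proof.
split.
  exists (ker_sheaf (alpha_beta_unit_hom F)), (ker_hom (alpha_beta_unit_hom F)).
  split; first exact: ker_homP.
  apply/ephemeralP => U s; apply: sub_incl_inj; rewrite raddf0.
  have := sub_inclP s; rewrite alpha_beta_unit_homE.
  move=> /(congr1 (restr (sval F) (@sub_beta_alpha U))).
  rewrite (restr_comp _ _ (@subset_refl _ (beta g U))) restr_id => ->.
  exact: raddf0.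
exists (coker_sheaf cone_translate_min (alpha_beta_unit_hom F)).
exists (coker_hom cone_translate_min (alpha_beta_unit_hom F)).
split; first exact: (coker_homP cone_translate_mem).
apply/ephemeralP => U c; apply: coset_ext => x Ux; rewrite coset0.
have [oU _] := svalP U.
have [y [a [Uy ga yax]]] := open_sub_cone_int oU Ux.
have yx : (cone_translate y : set V) x.
  by exists y => //; exists a => //; exact: cone_int_sub.
rewrite -(coset_coherent c Uy Ux yx).
have [t <-] := stalk_pi_surj (coset c Uy).
rewrite stalk_restrE; apply/stalk_pi_eq0.
(* t is a section over y + Int(gamma), not merely over y + gamma *)
have h : cone_translate x `<=` beta g (alpha g (cone_translate y)).
  move=> _ [_ -> [b gb <-]]; exists y; first exact: cone_translate_mem.
  by exists (a + b); [exact: cone_intD|rewrite addrA yax].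
exists (restr (sval F) h t); rewrite alpha_beta_unit_homE.
rewrite (restr_comp _ _ (subset_trans (@alpha_sub _) h)).
exact: (restr_irr (G := sval F) _
  (site_mono (s := beta g) (site_mono (s := alpha g) (cone_translate_min yx))) t).
Qed.

End Cone.

(** * The equivalence *)

Theorem theorem3p6 (R : realType) (V : normedVectType R) (gamma : proper_cone V)
    (k : fieldType)
    (alpha_inv : functor (Mod k (Valex gamma)) (Mod k (Vgamma gamma)))
    (alpha_adj : adjunction alpha_inv (direct_image k (alpha gamma))) :
  exists Phi : functor
      (serre_quotient (fun F : Mod k (Valex gamma) => is_ephemeral F))
      (Mod k (Vgamma gamma)),
    natiso
      (compF Phi (serre_quotient_functor
        (fun F : Mod k (Valex gamma) => is_ephemeral F)))
      alpha_inv /\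
    is_equivalence Phi.
Proof.
exists (loc_lift (@beta_inverts _ _ gamma k)); split.
  apply: natiso_trans (loc_liftE _) _.
  exact: left_adjoint_unique (alpha_beta_adjunction gamma k) alpha_adj.
apply: loc_lift_equivalence; first exact: alpha_beta_unit_ker_coker.
exact: alpha_beta_counit_iso.
Qed.
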